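(* Let $l\ge 1$ be an integer and let $k=l+1$. Then the following two statements are equivalent. (I) For every $n\ge 1$ and every colouring of the edges of $K_n$ (on vertex set $[n]$) in $k$ colours, there are sets $A_1,\dots,A_{k-1}\subseteq[n]$ whose union is $[n]$, and colours $c_1,\dots,c_{k-1}\in[k]$, such that $K_n[A_i,c_i]$ is connected for each $i\in[k-1]$. (II) For every finite set $X\subset\mathbb{N}_0^l$ there are $l$ sets $X_1,\dots,X_l\subseteq X$ with $X_1\cup\dots\cup X_l=X$ such that each $X_i$ is either contained in a hyperplane of the form $\{x\in\mathbb{N}_0^l\colon x_j=c\}$ (for some $j\in[l]$ and some $c\in\mathbb{N}_0$), or the induced subgraph $G_l[X_i]$ is connected.
   Context: $[m]=\{1,\dots,m\}$ and $\mathbb{N}_0=\{0,1,2,\dots\}$. Edge colourings are arbitrary (adjacent edges may receive the same colour). For a given edge colouring $\chi$ of $K_n$, a set of vertices $A$ and a colour $c$, $K_n[A,c]$ denotes the graph with vertex set $A$ and edge set $\{xy\colon x,y\in A,\ x\ne y,\ \chi(xy)=c\}$. $G_l$ is the graph with vertex set $\mathbb{N}_0^l$ in which $x$ and $y$ are adjacent if and only if $x_i\neq y_i$ for every coordinate $i\in[l]$; $G_l[X]$ is its subgraph induced on $X$. *)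

(* Defs.v *)
From mathcomp Require Import all_boot finmap.

Set Implicit Arguments.
Unset Strict Implicit.
Unset Printing Implicit Defensive.

(* The graph without vertices counts as connected. *)
Definition connected_graph (V : finType) (e : rel V) : Prop :=
  forall x y : V, connect e x y.

(* The graph K_n[A, c], on the subtype of elements of A. The edge colouring is
   given as a symmetric function chi, whose values on the diagonal are junk. *)
Definition colour_graph (n k : nat) (chi : 'I_n -> 'I_n -> 'I_k)
    (A : {set 'I_n}) (c : 'I_k) : rel {x : 'I_n | x \in A} :=
  fun x y => (val x != val y) && (chi (val x) (val y) == c).

Arguments colour_graph {n k} chi A c.

(* Adjacency in G_l; it is irreflexive for l > 0. *)
Definition Gadj (l : nat) : rel {ffun 'I_l -> nat} :=
  fun x y => [forall i, x i != y i].

Definition Ginduced (l : nat) (X : {fset {ffun 'I_l -> nat}}) : rel X :=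
  fun x y => Gadj (val x) (val y).

Arguments Ginduced {l} X.

(* Main.v *)
Require Import Defs.
From mathcomp Require Import all_boot finmap.

(** Single out the last colour of [l.+1] and let the other [l] colours play the
    role of the coordinates of [nat ^ l].

    From points to colourings: join two points of [X] by an edge whose colour
    is a coordinate in which they agree, or the last colour if there is none.
    A set connected in colour [j < l] lies in a hyperplane, because the [j]-th
    coordinate is constant along its edges, and the last colour class is
    exactly the adjacency of [G_l].

    From colourings to points: send a vertex [v] to the point whose [j]-th
    coordinate names the component of [v] in colour [j < l].  A hyperplane
    pulls back into one component of a colour [j].  Vertices whose points are
    adjacent in [G_l] share no component of the first [l] colours, so that the
    edge between them has the last colour; hence a connected subgraph of [G_l]
    with at least two vertices pulls back into one component of the last
    colour ([connected_pullback]).  A single point lies in a hyperplane, as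
    [l >= 1].  The pieces found this way are connected only inside [K_n], but
    each may be enlarged to the whole component that contains it
    ([enlarge_to_component]). *)

Set Implicit Arguments.
Unset Strict Implicit.
Unset Printing Implicit Defensive.

(** * Transporting connectedness *)

Lemma connect_least (T : finType) (e : rel T) (R : T -> T -> Prop) :
  (forall x, R x x) -> (forall y x z, R x y -> R y z -> R x z) ->
  (forall x y, e x y -> R x y) ->
  forall x y, connect e x y -> R x y.
Proof.
move=> Rxx Rtr eR x y /connectP[p + ->] {y}.
elim: p x => [|z p IHp] x /=; first by move=> _; exact: Rxx.
by case/andP=> /eR xRz /IHp; exact: Rtr.
Qed.

Lemma connect_neighbour (T : finType) (e : rel T) (x y : T) :
  connect e x y -> x != y -> exists z, e x z.
Proof.
case/connectP=> [[|z p] /= + ->]; first by rewrite eqxx.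
by case/andP=> exz _ _; exists z.
Qed.

(** Consecutive vertices of a path in the target have adjacent preimages, so
    that the path lifts.  Two preimages of the same [t] are joined through a
    preimage of a neighbour of [t]; connectedness and a second vertex provide
    this neighbour. *)
Lemma connected_pullback (S T : finType) (e : rel S) (e' : rel T)
    (r : S -> T -> Prop) :
  (forall t, exists s, r s t) ->
  (forall s s' t t', r s t -> r s' t' -> e' t t' -> e s s') ->
  symmetric e' -> (forall t t', connect e' t t') ->
  (forall t : T, exists t' : T, t != t') ->
  forall s s' t t', r s t -> r s' t' -> connect e s s'.
Proof.
move=> r_onto r_edge e'C e'conn two s s' t t' rst rst'.
pose R x y := forall u v, r u x -> r v y -> connect e u v.
suff: R t t' by apply.
apply: (connect_least (e := e')) (e'conn t t') => {s s' t t' rst rst'}.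
- move=> x u v rux rvx; have [y neq_xy] := two x.
  have [z xz] := connect_neighbour (e'conn x y) neq_xy.
  have [w rwz] := r_onto z.
  apply: (@connect_trans _ _ w); apply: connect1; first exact: r_edge xz.
  by apply: r_edge rwz rvx _; rewrite e'C.
- move=> y x z Rxy Ryz u v rux rvz; have [w rwy] := r_onto y.
  by apply: connect_trans (Rxy _ _ rux rwy) (Ryz _ _ rwy rvz).
- by move=> x y xy u v rux rvy; apply: connect1; exact: r_edge xy.
Qed.

(** * Monochromatic components *)

Section ColouredCompleteGraph.

Variables (n k : nat) (chi : 'I_n -> 'I_n -> 'I_k).
Hypothesis chiC : forall x y, chi x y = chi y x.

Definition colour_rel (c : 'I_k) : rel 'I_n :=
  fun x y => (x != y) && (chi x y == c).

Lemma colour_rel_sym c : symmetric (colour_rel c).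
Proof. by move=> x y; rewrite /colour_rel eq_sym chiC. Qed.

Lemma colour_connect_sym c : connect_sym (colour_rel c).
Proof. exact: sym_connect_sym (colour_rel_sym c). Qed.

Lemma component_connected c u :
  connected_graph (colour_graph chi [set v | connect (colour_rel c) u v] c).
Proof.
set B := [set v | _].
(* Membership of [b] in [B] is part of the conclusion, so that transitivity
   keeps the whole path inside [B]. *)
pose R a b := forall ha : a \in B, exists hb : b \in B,
  connect (colour_graph chi B c) (exist _ a ha) (exist _ b hb).
have BR a b : connect (colour_rel c) a b -> R a b.
  apply: connect_least => {a b} [a ha | b a d Rab Rbd ha | a b ab ha].
  - by exists ha; exact: connect0.
  - have [hb ab] := Rab ha; have [hd bd] := Rbd hb.
    by exists hd; exact: connect_trans ab bd.
  - have hb : b \in B.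
      by move: ha; rewrite !inE => /connect_trans; apply; exact: connect1.
    by exists hb; exact: connect1.
case=> x hx [y hy].
have xy : connect (colour_rel c) x y.
  apply: (@connect_trans _ _ u); last by rewrite inE in hy.
  by rewrite colour_connect_sym; rewrite inE in hx.
have [hy' xy'] := BR _ _ xy hx.
by rewrite (_ : exist _ y hy = exist _ y hy') //; apply: val_inj.
Qed.

(** The graph induced on [A] itself may be disconnected, as the paths between
    vertices of [A] can leave [A]; a whole component contains them. *)
Lemma enlarge_to_component c (A : {set 'I_n}) :
  {in A &, forall u v, connect (colour_rel c) u v} ->
  exists2 B : {set 'I_n},
    A \subset B & connected_graph (colour_graph chi B c).
Proof.
have [-> _ | [u uA] Aconn] := set_0Vmem A.
  by exists set0 => // -[x hx]; exfalso; rewrite inE in hx.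
exists [set v | connect (colour_rel c) u v]; last exact: component_connected.
by apply/subsetP => v vA; rewrite inE; exact: Aconn.
Qed.

End ColouredCompleteGraph.

(** * The colouring of a family of points *)

Lemma GadjC l : symmetric (@Gadj l).
Proof. by move=> x y; apply: eq_forallb => i; rewrite eq_sym. Qed.

Section AgreementColouring.

Variables (n l : nat) (f : 'I_n -> {ffun 'I_l -> nat}).

Definition agreement_colour (u v : 'I_n) : 'I_l.+1 :=
  if [pick j | f u j == f v j] is Some j then lift ord_max j else ord_max.

Lemma agreement_colourC u v : agreement_colour u v = agreement_colour v u.
Proof.
rewrite /agreement_colour.
by rewrite (@eq_pick _ _ [pred j | f v j == f u j]) // => j; rewrite /= eq_sym.
Qed.

Lemma agreement_colour_lift u v j :
  agreement_colour u v = lift ord_max j -> f u j = f v j.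
Proof.
rewrite /agreement_colour; case: pickP => [i /eqP fi /lift_inj <- // | _ /eqP].
by rewrite (negPf (neq_lift _ _)).
Qed.

Lemma agreement_colour_max u v :
  agreement_colour u v = ord_max -> Gadj (f u) (f v).
Proof.
rewrite /agreement_colour; case: pickP => [i _ /eqP | fuv _].
  by rewrite eq_sym (negPf (neq_lift _ _)).
by apply/forallP => i; rewrite fuv.
Qed.

(** [f] carries edges of the last colour to adjacent points, and its [j]-th
    coordinate is constant along edges of colour [j < l]. *)
Lemma agreement_piece (A : {set 'I_n}) c :
  0 < l -> connected_graph (colour_graph agreement_colour A c) ->
  (exists (j : 'I_l) (d : nat),
     forall x, x \in [fset f v | v in A]%fset -> x j = d) \/
  connected_graph (Ginduced [fset f v | v in A]%fset).
Proof.
move=> l_gt0 Aconn; case: (unliftP ord_max c) => [j | ] c_def.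
  left; exists j; have [A0 | [u uA]] := set_0Vmem A.
    exists 0 => x /imfsetP[v /= vA _].
    by exfalso; rewrite A0 inE in vA.
  exists (f u j) => _ /imfsetP[v /= vA ->].
  have := Aconn (exist _ v vA) (exist _ u uA).
  apply: (connect_least (R := fun a b => f (val a) j = f (val b) j)).
  - by [].
  - by move=> b a d -> ->.
  - move=> a b /andP[_ /eqP ab].
    by apply: agreement_colour_lift; rewrite ab.
right=> -[x hx] [y hy].
have [u /= uA x_def] := imfsetP _ _ _ _ hx.
have [v /= vA y_def] := imfsetP _ _ _ _ hy.
have inY a : a \in A -> f a \in [fset f v | v in A]%fset.
  by move=> aA; exact: in_imfset.
pose h (a : {a | a \in A}) := [` inY _ (valP a)]%fset.
rewrite (_ : [` hx]%fset = h (exist _ u uA)); last exact: val_inj.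
rewrite (_ : [` hy]%fset = h (exist _ v vA)); last exact: val_inj.
have := Aconn (exist _ u uA) (exist _ v vA).
apply: (connect_least (R := fun a b => connect _ (h a) (h b))).
- by move=> a; exact: connect0.
- by move=> b a d; exact: connect_trans.
- move=> a b /andP[_ /eqP ab]; apply: connect1.
  by apply: agreement_colour_max; rewrite ab.
Qed.

End AgreementColouring.

(** * The points of a colouring *)

Section ComponentPoints.

Variables (n l : nat) (chi : 'I_n -> 'I_n -> 'I_l.+1).
Hypothesis chiC : forall x y, chi x y = chi y x.

Definition component_point (v : 'I_n) : {ffun 'I_l -> nat} :=
  [ffun j => val (root (colour_rel chi (lift ord_max j)) v)].

Lemma component_point_eq u v j :
  component_point u j = component_point v j ->
  connect (colour_rel chi (lift ord_max j)) u v.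
Proof.
rewrite !ffunE => /val_inj/eqP.
by rewrite root_connect //; exact: colour_connect_sym.
Qed.

Lemma component_point_adj u v :
  0 < l -> Gadj (component_point u) (component_point v) ->
  colour_rel chi ord_max u v.
Proof.
move=> l_gt0 /forallP adj.
have neq_uv : u != v.
  by apply: contraNneq (adj (Ordinal l_gt0)) => ->.
rewrite /colour_rel neq_uv /=.
case: (unliftP ord_max (chi u v)) => [j chi_uv | -> //].
have := adj j; rewrite !ffunE => /eqP[]; congr val; apply/eqP.
rewrite root_connect; last exact: colour_connect_sym.
by apply: connect1; rewrite /colour_rel neq_uv chi_uv /=.
Qed.

(** All vertices over a point of a hyperplane [x j = d] lie in the component of
    colour [j] named [d].  The case of a connected [Y] reduces to this one when
    [Y] has a single point, and otherwise [Y] pulls back to a set connected in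
    the last colour. *)
Lemma component_point_piece (Y : {fset {ffun 'I_l -> nat}}) :
  0 < l -> (forall x, x \in Y -> exists v, x = component_point v) ->
  (exists (j : 'I_l) (d : nat), forall x, x \in Y -> x j = d) \/
    connected_graph (Ginduced Y) ->
  exists c, {in [set v | component_point v \in Y] &,
    forall u v, connect (colour_rel chi c) u v}.
Proof.
move=> l_gt0 Yim Ypiece.
have hyperplane : (exists (j : 'I_l) (d : nat), forall x, x \in Y -> x j = d) ->
    exists c, {in [set v | component_point v \in Y] &,
      forall u v, connect (colour_rel chi c) u v}.
  case=> j [d Yd]; exists (lift ord_max j) => u v.
  rewrite !inE => /Yd ud /Yd vd.
  by apply: component_point_eq; rewrite ud vd.
case: Ypiece => [/hyperplane // | Yconn].
case: (boolP [forall x : Y, exists y : Y, x != y]) => [/forallP two | ].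
  exists ord_max => u v; rewrite !inE => uY vY.
  apply: (@connected_pullback _ _ _ (Ginduced Y)
            (fun v x => component_point v = val x) _ _ _ Yconn _
            u v [` uY]%fset [` vY]%fset) => //.
  - by move=> x; have [w ->] := Yim _ (valP x); exists w.
  - by move=> a b x y ax bY xy; apply: component_point_adj; rewrite // ax bY.
  - by move=> x y; exact: GadjC.
  - by move=> x; exact/existsP.
(* Some [x] equals every point of [Y], so any coordinate is constant on [Y]. *)
rewrite negb_forall => /existsP[x]; rewrite negb_exists => /forallP one.
apply: hyperplane; exists (Ordinal l_gt0), (val x (Ordinal l_gt0)) => y yY.
by have := one [` yY]%fset; rewrite negbK => /eqP ->.
Qed.

End ComponentPoints.

Theorem proposition9 (l k : nat) (hl : 1 <= l) (hk : k = l.+1) :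
  (forall n : nat, 1 <= n ->
   forall chi : 'I_n -> 'I_n -> 'I_k,
     (forall x y : 'I_n, chi x y = chi y x) ->
     exists (A : 'I_k.-1 -> {set 'I_n}) (c : 'I_k.-1 -> 'I_k),
       \bigcup_(i : 'I_k.-1) A i = [set: 'I_n] /\
       (forall i : 'I_k.-1, connected_graph (colour_graph chi (A i) (c i))))
  <->
  (forall X : {fset {ffun 'I_l -> nat}},
     exists Y : 'I_l -> {fset {ffun 'I_l -> nat}},
       [/\ forall i : 'I_l, (Y i `<=` X)%fset,
           (\bigcup_(i in 'I_l) Y i)%fset = X
         & forall i : 'I_l,
             (exists (j : 'I_l) (c : nat), forall x, x \in Y i -> x j = c) \/
             connected_graph (Ginduced (Y i))]).
Proof.
subst k; split=> [colourings X | points n _ chi chiC].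
  have [-> | [x0 x0X]] := fset_0Vmem X.
    exists (fun=> fset0); split=> [i | | i]; first exact: fsub0set.
    - by apply/fsetP=> x; rewrite inE; apply/bigfcupP=> -[i _]; rewrite inE.
    - by left; exists (Ordinal hl), 0 => x; rewrite inE.
  have X_gt0 : 0 < #|{: X}| by apply/card_gt0P; exists [` x0X]%fset.
  pose f (i : 'I_#|{: X}|) : {ffun 'I_l -> nat} := val (enum_val i).
  have fX i : f i \in X by exact: valP.
  have [A [c [Acover Aconn]]] := colourings _ X_gt0 _ (agreement_colourC f).
  have subX i : ([fset f v | v in A i] `<=` X)%fset.
    by apply/fsubsetP=> _ /imfsetP[v _ ->].
  exists (fun i => [fset f v | v in A i]%fset); split=> // [|i].
    apply/fsetP=> x; apply/bigfcupP/idP => [[i _] | xX].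
      by apply: fsubsetP.
    have : enum_rank [` xX]%fset \in \bigcup_(i < l) A i.
      by rewrite Acover inE.
    case/bigcupP=> i _ xA; exists i; first by rewrite mem_index_enum.
    by apply/imfsetP; exists (enum_rank [` xX]%fset); rewrite // /f enum_rankK.
  exact: agreement_piece (Aconn i).
pose f := component_point chi.
have [Y [YX Ycover Ypiece]] := points [fset f v | v in 'I_n]%fset.
have pieces i : exists c, exists2 B : {set 'I_n},
    [set v | f v \in Y i] \subset B & connected_graph (colour_graph chi B c).
  have Yim x : x \in Y i -> exists v, x = f v.
    by move/(fsubsetP (YX i))=> /imfsetP[v _ ->]; exists v.
  have [c cconn] := component_point_piece chiC hl Yim (Ypiece i).
  by exists c; exact: enlarge_to_component.
have [c /fin_all_exists2[B YB Bconn]] := fin_all_exists pieces.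
exists B, c; split=> //; apply/setP=> v; rewrite inE.
have : f v \in (\bigcup_(i in 'I_l) Y i)%fset.
  by rewrite Ycover; exact: in_imfset.
case/bigfcupP=> i _ vY; apply/bigcupP; exists i => //.
by apply: (subsetP (YB i)); rewrite inE.
Qed.
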